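(* Let $k,n$ be integers with $n\ge k+2\ge4$. Every cluster variable of $\mathbb{C}[\mathbb{G}(k,n)]$ is positive, i.e. it takes positive values at every point of $X(k,n)^+$, the set of points of the affine cone of the real Grassmannian all of whose Plücker coordinates are positive.
   Context: Grassmannian. $X(k,n)\subset\bigwedge^k\mathbb{C}^n$ is the affine cone of decomposable $k$-forms, with Plücker coordinates $\Delta^K$ indexed by $k$-subsets $K\subset\{1,\dots,n\}$. $\mathbb{C}[\mathbb{G}(k,n)]$ denotes the coordinate ring of $X(k,n)$. $X(k,n)^+$ is the set of real points $p$ of the cone with $\Delta^K(p)>0$ for all $k$-subsets $K$. Seeds and mutation. A seed in a field $\mathcal{F}$ of rational functions over $\mathbb{C}$ in $M$ variables is a triple $(\mathbf{x},\mathbf{c},\tilde B)$ where $\tilde{\mathbf{x}}=\mathbf{x}\sqcup\mathbf{c}$ is a transcendence basis of $\mathcal{F}$ ($M$ algebraically independent elements) and $\tilde B=(b_{x,y})$ is an integer matrix with rows indexed by $\tilde{\mathbf x}$ and columns by $\mathbf{x}$ whose square submatrix with rows in $\mathbf{x}$ is skew-symmetrizable. For $z\in\mathbf{x}$, $\mu_z(\mathbf{x},\mathbf{c},\tilde B)=(\mathbf{x}-\{z\}\cup\{z'\},\mathbf{c},\tilde B')$, where $zz'=\prod_{b_{x,z}>0}x^{b_{x,z}}+\prod_{b_{x,z}<0}x^{-b_{x,z}}$ and $b'_{x,y}=-b_{x,y}$ if $x=z$ or $y=z$, $b'_{x,y}=b_{x,y}+\frac{|b_{x,z}|b_{z,y}+b_{x,z}|b_{z,y}|}{2}$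 otherwise (index $z$ renamed $z'$). Clusters are the sets $\mathbf{x}$ in seeds obtained from an initial seed by iterated mutation; their elements are the cluster variables. Cluster structure on $\mathbb{C}[\mathbb{G}(k,n)]$. $\mathcal{F}$ is the fraction field of $\mathbb{C}[\mathbb{G}(k,n)]$; all cluster variables lie in $\mathbb{C}[\mathbb{G}(k,n)]$. For $0\le i\le k$, $0\le j\le n-k$ put $p_{ij}=n-k-\lfloor\frac{i+j-2}{2}\rfloor$, $p'_{ij}=n-k+2+\lfloor\frac{i+j-1}{2}\rfloor$ and $I_{ij}=\{p_{ij},\dots,p_{ij}+i-1\}\sqcup\{p'_{ij},\dots,p'_{ij}+k-i-1\}$ (mod $n$; only non-corner pairs $(i,j)$ are used). The initial cluster is $\{\Delta^{I_{ij}}: 1\le i\le k-1,\ 1\le j\le n-k-1\}$; the coefficients $\mathbf{c}$ are the $\Delta^{K}$ for the $n$ cyclic intervals $K$ of length $k$ (these are the $I_{ij}$ with $i\in\{0,k\}$ or $j\in\{0,n-k\}$). In the column of $\tilde B$ indexed by $I_{ij}$ the entries in rows $I_{i\pm1,j}$ equal $(-1)^{i+j}$, the entries in rows $I_{i,j\pm1}$ equal $-(-1)^{i+j}$, and all other entries are $0$. *)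

(* Defs.v *)
From HB Require Import structures.
From mathcomp Require Import all_boot all_order all_algebra.
From mathcomp Require Import fraction complex mpoly.
From mathcomp Require Import boolp functions reals.
From mathcomp Require Import zify.

Set Implicit Arguments.
Unset Strict Implicit.
Unset Printing Implicit Defensive.

Import Order.TTheory GRing.Theory Num.Theory.

Local Open Scope ring_scope.
Local Open Scope complex_scope.

Notation "x %:F" := (@FracField.tofrac _ x) : ring_scope.

(* The ordinal a : 'I_n stands for the element a + 1 of {1, ..., n}. *)
Definition ksubset (k n : nat) : Type := {K : {set 'I_n} | #|K| == k}.

HB.instance Definition _ k n := Finite.on (ksubset k n).

Section Grassmannian.
Variables (R : realType) (k n : nat).
Local Notation C := R[i].
Implicit Type K : ksubset k n.

(* A k-form is given by its coordinates in the basis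
   e_{K_0} /\ ... /\ e_{K_{k-1}}, where K_0 < ... < K_{k-1} lists K. *)
Local Notation kform := {ffun ksubset k n -> C}.

Definition kth_elt K (b : 'I_k) : 'I_n :=
  enum_val (cast_ord (esym (eqP (valP K))) b).

Definition wedge (v : 'I_k -> 'rV[C]_n) : kform :=
  [ffun K => \det (\matrix_(a < k, b < k) v a 0 (kth_elt K b))].

Definition decomposable (w : kform) : Prop := exists v, w = wedge v.

(* The affine cone X(k,n). *)
Record gcone := GCone { gcone_form :> kform; gconeP : decomposable gcone_form }.

(* In R[i], 0 < z means that z is real and positive. *)
Definition gcone_pos (p : gcone) : Prop := forall K, 0 < p K.

(* Regular functions on X(k,n): restrictions of polynomials in the
   coordinates of the space of k-forms. *)
Definition regular : {pred gcone -> C} := fun f =>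
  `[< exists P : {mpoly C[#|{: ksubset k n}|]},
        forall p : gcone, f p = P.@[fun a => p (enum_val a)] >].

(* The coordinate ring C[G(k,n)]. *)
Record coord_ring := CoordRing {
  coord_fun :> gcone -> C;
  _ : coord_fun \in regular }.

HB.instance Definition _ := [isSub for coord_fun].
HB.instance Definition _ := [Choice of coord_ring by <:].

Fact regular_subring : subring_closed regular.
Proof.
split=> [|f g|f g].
- by apply/asboolP; exists 1 => p; rewrite meval1.
- move=> /asboolP[P fP] /asboolP[Q gQ]; apply/asboolP; exists (P - Q) => p.
  by rewrite mevalB -fP -gQ.
- move=> /asboolP[P fP] /asboolP[Q gQ]; apply/asboolP; exists (P * Q) => p.
  by rewrite mevalM -fP -gQ.
Qed.

HB.instance Definition _ :=
  GRing.SubChoice_isSubComPzRing.Build (gcone -> C) regular coord_ring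
    regular_subring.

Fact coord_ring_oner_neq0 : (1 : coord_ring) != 0.
Proof.
apply/eqP => /(congr1 (fun f : coord_ring => f (GCone (ex_intro _ 0 erefl)))).
by move/eqP; rewrite /= oner_eq0.
Qed.

HB.instance Definition _ :=
  GRing.PzSemiRing_isNonZero.Build coord_ring coord_ring_oner_neq0.

Definition coord_unit : {pred coord_ring} := fun f => `[< exists g, g * f = 1 >].

Definition coord_inv (f : coord_ring) : coord_ring :=
  if pselect (exists g, g * f = 1) is left H then sval (cid H) else f.

Fact coord_mulVf : {in coord_unit, left_inverse 1 coord_inv *%R}.
Proof.
move=> f /asboolP Uf; rewrite /coord_inv.
by case: pselect => // H; case: cid.
Qed.

Fact coord_unitP (f g : coord_ring) : g * f = 1 -> coord_unit f.
Proof. by move=> gf; apply/asboolP; exists g. Qed.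

Fact coord_inv_out : {in [predC coord_unit], coord_inv =1 id}.
Proof.
move=> f /negP Uf; rewrite /coord_inv; case: pselect => // H.
by case: Uf; apply/asboolP.
Qed.

HB.instance Definition _ :=
  GRing.ComNzRing_hasMulInverse.Build coord_ring
    coord_mulVf coord_unitP coord_inv_out.

Lemma coord_ringP (f g : coord_ring) : (forall p, f p = g p) -> f = g.
Proof. by move=> fg; apply: val_inj; apply/funext. Qed.

Fact coord_line (f : coord_ring) (v w : 'I_k -> 'rV[C]_n) :
  exists q : {poly C}, forall (t : C) (p : gcone),
    p = wedge (fun a => v a + t *: (w a - v a)) :> kform -> f p = q.[t].
Proof.
have /asboolP[P FP] := valP f.
pose M (i : 'I_#|{: ksubset k n}|) : 'M[{poly C}]_k :=
  \matrix_(a < k, b < k) ((v a 0 (kth_elt (enum_val i) b))%:P +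
    'X * ((w a - v a) 0 (kth_elt (enum_val i) b))%:P).
exists (mmap (@polyC C) (fun i => \det (M i)) P) => t p pE.
rewrite FP -[RHS]/(horner_eval t _) /mmap rmorph_sum /= mevalE.
apply: eq_bigr => m _; rewrite rmorphM /= /horner_eval hornerC; congr (_ * _).
rewrite /mmap1 -/(horner_eval t _) rmorph_prod; apply: eq_bigr => i _.
rewrite rmorphXn /= -det_map_mx pE ffunE; congr (\det _ ^+ _).
apply/matrixP => a b; rewrite !mxE /= /horner_eval.
by rewrite hornerD hornerM !hornerC hornerX.
Qed.

Fact coord_ring_integral : GRing.integral_domain_axiom coord_ring.
Proof.
move=> f g fg0; apply: contraT; rewrite negb_or.
move=> /andP[f_neq0 g_neq0].
have nz (h : coord_ring) : h != 0 ->
    exists v, exists2 p : gcone, p = wedge v :> kform & h p != 0.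
  move=> /eqP h_neq0; apply: contrapT => nE; apply: h_neq0.
  apply: coord_ringP => p; apply: contrapT => /eqP hp; apply: nE.
  by have [v pE] := gconeP p; exists v, p.
have [v [p pE fp]] := nz _ f_neq0; have [w [p' p'E gp]] := nz _ g_neq0.
have [q qP] := coord_line f v w; have [r rP] := coord_line g v w.
have q_neq0 : q != 0.
  apply: contraNneq fp => q0; rewrite (qP 0) ?q0 ?horner0 // pE.
  by congr wedge; apply/funext => a; rewrite scale0r addr0.
have r_neq0 : r != 0.
  apply: contraNneq gp => r0; rewrite (rP 1) ?r0 ?horner0 // p'E.
  by congr wedge; apply/funext => a; rewrite scale1r addrC subrK.
have /eqP[] : q * r != 0 by rewrite mulf_neq0.
apply: (@roots_geq_poly_eq0 _ _ [seq i%:R | i <- iota 0 (size (q * r))]).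
- apply/allP => _ /mapP[i _ ->]; rewrite /root hornerM.
  pose u a := v a + i%:R *: (w a - v a).
  pose pt := GCone (ex_intro _ u erefl).
  rewrite -(qP i%:R pt) // -(rP i%:R pt) //.
  by have /(congr1 (fun h : coord_ring => h pt)) /= := fg0 => /eqP.
- rewrite map_inj_uniq ?iota_uniq //.
  by move=> i j /eqP; rewrite eqr_nat => /eqP.
- by rewrite size_map size_iota.
Qed.

HB.instance Definition _ :=
  GRing.ComUnitRing_isIntegral.Build coord_ring coord_ring_integral.

(* y takes the value c at p: y is a quotient of regular functions whose
   denominator does not vanish at p.  By takes_value_uniq there is at most one
   such c, and by takes_value_regular it is f p when y is the regular
   function f. *)
Definition takes_value (y : {fraction coord_ring}) (p : gcone) (c : C) : Prop :=
  exists f g : coord_ring, [/\ g p != 0, y = f%:F / g%:F & c = f p / g p].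

Lemma takes_value_uniq y p c d :
  takes_value y p c -> takes_value y p d -> c = d.
Proof.
have nz (g : coord_ring) : g p != 0 -> g%:F != 0 :> {fraction coord_ring}.
  by move=> gp; rewrite tofrac_eq0; apply: contraNneq gp => ->.
move=> [f [g [gp -> ->]]] [f' [g' [gp' /eqP]]].
rewrite eqr_div ?nz // -!tofracM tofrac_eq => /eqP.
move=> /(congr1 (fun h : coord_ring => h p)) /= e ->.
by apply/eqP; rewrite eqr_div //; apply/eqP.
Qed.

Lemma takes_value_regular (f : coord_ring) p c :
  takes_value f%:F p c <-> c = f p.
Proof.
have fp : takes_value f%:F p (f p).
  exists f, 1; split; first by rewrite oner_neq0.
    by rewrite tofrac1 divr1.
  by rewrite -[(1 : coord_ring) p]/(1 : C) divr1.
by split=> [fc|->//]; apply: takes_value_uniq fp.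
Qed.

Fact plucker_regular (K : {set 'I_n}) :
  (fun p : gcone => if insub K is Some K' then p K' else 0) \in regular.
Proof.
apply/asboolP; case: insubP => [K' _ _|_]; last first.
  by exists 0 => p; rewrite meval0.
by exists 'X_(enum_rank K') => p; rewrite mevalXU enum_rankK.
Qed.

(* The Pluecker coordinate Delta^K; the default 0 for #|K| != k is never used
   below, by card_label_set. *)
Definition plucker (K : {set 'I_n}) : coord_ring := CoordRing (plucker_regular K).

End Grassmannian.

(* A seed, with the extended cluster and the matrix indexed by fixed labels
   I + J: mutation replaces the variable with label z, the new one keeping that
   label.  The algebraic independence of the extended cluster and the
   skew-symmetrizability of the principal part are preserved by mutation and
   are not recorded. *)
Record seed (F : fieldType) (I J : finType) := Seed {
  cluster : I -> F;
  coeffs : J -> F;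
  exch : I + J -> I -> int }.

Section Mutation.
Variables (F : fieldType) (I J : finType).
Implicit Types (S : seed F I J) (z : I).

Definition ext_cluster S (r : I + J) : F :=
  match r with inl i => cluster S i | inr j => coeffs S j end.

Definition exchange_rhs S z : F :=
  \prod_(r | 0 < exch S r z) ext_cluster S r ^+ `|exch S r z|%N +
  \prod_(r | exch S r z < 0) ext_cluster S r ^+ `|exch S r z|%N.

(* The integer division by 2 is exact. *)
Definition mutate S z : seed F I J := {|
  cluster := fun i =>
    if i == z then exchange_rhs S z / cluster S z else cluster S i;
  coeffs := coeffs S;
  exch := fun r y =>
    if (r == inl z) || (y == z) then - exch S r y
    else exch S r y +
      ((`|exch S r z| * exch S (inl z) y + exch S r z * `|exch S (inl z) y|)
         %/ 2)%Z |}.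

Inductive mutation_equiv (S0 : seed F I J) : seed F I J -> Prop :=
| mutation_refl : mutation_equiv S0 S0
| mutation_step S z : mutation_equiv S0 S -> mutation_equiv S0 (mutate S z).

Definition cluster_variable (S0 : seed F I J) (y : F) : Prop :=
  exists2 S, mutation_equiv S0 S & exists z, y = cluster S z.

End Mutation.

Section InitialSeed.
Variables (k n : nat).

Definition p_idx (i j : nat) : int :=
  n%:Z - k%:Z - ((i%:Z + j%:Z - 2) %/ 2)%Z.

Definition p'_idx (i j : nat) : int :=
  n%:Z - k%:Z + 2 + ((i%:Z + j%:Z - 1) %/ 2)%Z.

(* The residues of s, s + 1, ..., s + l - 1 mod n in {1, ..., n}. *)
Definition cyc_interval (s : int) (l : nat) : {set 'I_n} :=
  [set a : 'I_n | [exists t : 'I_l, (a.+1%:Z == s + t%:Z %[mod n%:Z])%Z]].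

Definition I_set (i j : nat) : {set 'I_n} :=
  cyc_interval (p_idx i j) i :|: cyc_interval (p'_idx i j) (k - i).

(* The mutable label (i, j) stands for the pair (i + 1, j + 1), with
   1 <= i + 1 <= k - 1 and 1 <= j + 1 <= n - k - 1; the coefficients are
   labelled by the first element of the cyclic interval. *)
Definition mut_label : finType := ('I_k.-1 * 'I_(n - k).-1)%type.

Definition label_set (r : mut_label + 'I_n) : {set 'I_n} :=
  match r with
  | inl ij => I_set ij.1.+1 ij.2.+1
  | inr a => cyc_interval a.+1%:Z k
  end.

Fact dvdz_small (d q m : int) : d = q * m -> - m < d < m -> d = 0.
Proof.
move=> -> /andP[dl dr]; have [q0|q0|->] := ltgtP q 0; last by rewrite mul0r.
  by have : (q + 1) * m <= 0; [apply: mulr_le0_ge0; lia | lia].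
by have : 0 <= (q - 1) * m; [apply: mulr_ge0; lia | lia].
Qed.

Lemma card_cyc_interval (s : int) (l : nat) :
  (l <= n)%N -> #|cyc_interval s l| = l.
Proof.
move=> ln; case: (posnP n) => [n0|n_gt0].
  by rewrite eq_card0 => [|a]; [lia | have := ltn_ord a; lia].
have nz : n%:Z != 0 by lia.
have gP (t : 'I_l) : (`|((s + t%:Z - 1) %% n%:Z)%Z|%N < n)%N.
  by rewrite -ltz_nat gez0_abs ?modz_ge0 // ltz_pmod // ltz_nat.
pose g t := Ordinal (gP t).
have gE t : (((g t).+1)%:Z = s + t%:Z %[mod n%:Z])%Z.
  rewrite /= -addn1 PoszD gez0_abs ?modz_ge0 // modzDml.
  by congr (_ %% _)%Z; lia.
have g_inj : injective g.
  move=> t u tu; have := gE t; rewrite tu gE => /eqP.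
  rewrite eqz_mod_dvd => /dvdzP[q /dvdz_small qE]; apply: val_inj => /=.
  by have := ltn_ord t; have := ltn_ord u; lia.
rewrite -[RHS]card_ord -cardsT -(card_imset _ g_inj); apply: eq_card => a.
rewrite inE; apply/existsP/imsetP => [[t]|[t _ ->]]; last first.
  by exists t; rewrite gE.
rewrite -gE eqz_mod_dvd => /dvdzP[q /dvdz_small qE].
exists t => //; move: (g t) qE => b qE; apply: val_inj => /=.
by have := ltn_ord a; have := ltn_ord b; lia.
Qed.

Lemma card_I_set (i j : nat) :
  (i <= k)%N -> (0 < i + j)%N -> (j + k <= n)%N -> #|I_set i j| = k.
Proof.
move=> ik ij jk; rewrite cardsU !card_cyc_interval; try lia.
rewrite (_ : _ :&: _ = set0) ?cards0; first by lia.
apply/setP => a; rewrite !inE; apply/negP => /andP[].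
move=> /existsP[t /eqP at_] /existsP[u]; rewrite at_.
rewrite eqz_mod_dvd => /dvdzP[q /dvdz_small].
by have := ltn_ord t; have := ltn_ord u; rewrite /p_idx /p'_idx; lia.
Qed.

Lemma card_label_set (r : mut_label + 'I_n) :
  (k <= n)%N -> #|label_set r| = k.
Proof.
move=> kn; case: r => [[i j]|a] /=; last exact: card_cyc_interval.
by apply: card_I_set; have := ltn_ord i; have := ltn_ord j; lia.
Qed.

(* Rows are compared through the subsets they stand for, because one cyclic
   interval may be I_set i j for several boundary pairs (i, j). *)
Definition init_exch (r : mut_label + 'I_n) (y : mut_label) : int :=
  let i := y.1.+1 in
  let j := y.2.+1 in
  let K := label_set r in
  if (K == I_set i.-1 j) || (K == I_set i.+1 j) then (-1) ^+ (i + j)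
  else if (K == I_set i j.-1) || (K == I_set i j.+1) then - (-1) ^+ (i + j)
  else 0.

Definition init_seed (R : realType) :
    seed {fraction coord_ring R k n} mut_label 'I_n := {|
  cluster := fun ij => (plucker R k (label_set (inl ij)))%:F;
  coeffs := fun a => (plucker R k (label_set (inr a)))%:F;
  exch := init_exch |}.

End InitialSeed.

(* Main.v *)
Require Import Defs.
From HB Require Import structures.
From mathcomp Require Import all_boot all_order all_algebra.
From mathcomp Require Import fraction complex mpoly.
From mathcomp Require Import boolp functions reals.

(** Mutation is subtraction-free: a new cluster variable is a sum of two
monomials in the extended cluster, divided by an old cluster variable.  Fix a
point p of the cone whose Pluecker coordinates are all positive.  The rational
functions defined at p with positive value there contain 1 and are closed
under sums, products and quotients: the denominators that appear do not vanish
at p, since their values are positive ([positive_at_div]).  Hence mutation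
preserves the property that the whole extended cluster is positive at p
([positive_at_mutate]).  The initial extended
cluster consists of Pluecker coordinates, which are positive at p by
assumption ([positive_at_init]). *)

Set Implicit Arguments.
Unset Strict Implicit.
Unset Printing Implicit Defensive.

Import Order.TTheory GRing.Theory Num.Theory.

Local Open Scope ring_scope.
Local Open Scope complex_scope.

Section PositiveAt.
Variables (R : realType) (k n : nat) (p : gcone R k n).
Local Notation F := {fraction coord_ring R k n}.
Implicit Types (x y : F) (c d : R[i]) (g : coord_ring R k n).

Lemma tofrac_neq0_at g : g p != 0 -> g%:F != 0 :> F.
Proof. by move=> gp; rewrite tofrac_eq0; apply: contraNneq gp => ->. Qed.

Lemma takes_valueD x y c d :
  takes_value x p c -> takes_value y p d -> takes_value (x + y) p (c + d).
Proof.
move=> [f [g [gp -> ->]]] [f' [g' [gp' -> ->]]].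
exists (f * g' + f' * g), (g * g'); split; first exact: mulf_neq0.
  by rewrite tofracD !tofracM addf_div // tofrac_neq0_at.
by rewrite addf_div.
Qed.

Lemma takes_valueM x y c d :
  takes_value x p c -> takes_value y p d -> takes_value (x * y) p (c * d).
Proof.
move=> [f [g [gp -> ->]]] [f' [g' [gp' -> ->]]].
exists (f * f'), (g * g'); split; first exact: mulf_neq0.
  by rewrite !tofracM mulf_div.
by rewrite mulf_div.
Qed.

Lemma takes_valueV x c : c != 0 -> takes_value x p c -> takes_value x^-1 p c^-1.
Proof.
move=> + [f [g [gp -> cE]]]; rewrite {}cE => fgp.
exists g, f; split; last by rewrite invf_div.
  by apply: contraNneq fgp => ->; rewrite mul0r.
by rewrite invf_div.
Qed.

Definition positive_at y : Prop := exists2 c, takes_value y p c & 0 < c.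

Lemma positive_at_regular g : 0 < g p -> positive_at g%:F.
Proof. by move=> gp; exists (g p) => //; apply/takes_value_regular. Qed.

Lemma positive_at1 : positive_at 1.
Proof. by rewrite -tofrac1; apply: positive_at_regular; exact: ltr01. Qed.

Lemma positive_at_add x y : positive_at x -> positive_at y -> positive_at (x + y).
Proof.
move=> [c xc c0] [d yd d0].
by exists (c + d); [exact: takes_valueD | exact: addr_gt0].
Qed.

Lemma positive_at_mul x y : positive_at x -> positive_at y -> positive_at (x * y).
Proof.
move=> [c xc c0] [d yd d0].
by exists (c * d); [exact: takes_valueM | exact: mulr_gt0].
Qed.

Lemma positive_at_div x y : positive_at x -> positive_at y -> positive_at (x / y).
Proof.
move=> px [d yd d0]; apply: positive_at_mul => //.
exists d^-1; last by rewrite invr_gt0.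
by apply: takes_valueV => //; rewrite gt_eqF.
Qed.

Lemma positive_at_exp x m : positive_at x -> positive_at (x ^+ m).
Proof.
move=> px; elim: m => [|m IHm]; first by rewrite expr0; exact: positive_at1.
by rewrite exprS; apply: positive_at_mul.
Qed.

Section Seeds.
Variables I J : finType.
Implicit Type S : seed F I J.

Definition seed_positive_at S : Prop := forall r, positive_at (ext_cluster S r).

Lemma positive_at_monomial S (P : pred (I + J)) (e : I + J -> nat) :
  seed_positive_at S ->
  positive_at (\prod_(r | P r) ext_cluster S r ^+ e r).
Proof.
move=> pS; apply: big_ind => [||r _]; [exact: positive_at1 | | ].
  exact: positive_at_mul.
by apply: positive_at_exp.
Qed.

(** Both terms of the exchange relation are monomials with nonnegative
exponents, so its right-hand side is positive at p, and so is its quotient by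
the positive variable being replaced. *)
Lemma positive_at_mutate S z : seed_positive_at S -> seed_positive_at (mutate S z).
Proof.
move=> pS [i|j] /=; last exact: (pS (inr j)).
case: eqP => _; last exact: (pS (inl i)).
apply: positive_at_div; last exact: (pS (inl z)).
by apply: positive_at_add; apply: positive_at_monomial.
Qed.

Lemma positive_at_mutation_equiv S0 S :
  mutation_equiv S0 S -> seed_positive_at S0 -> seed_positive_at S.
Proof.
by move=> + pS0; elim=> // {}S z _ IH; apply: positive_at_mutate.
Qed.

End Seeds.

Lemma positive_at_plucker (K : {set 'I_n}) :
  gcone_pos p -> #|K| = k -> positive_at (plucker R k K)%:F.
Proof.
move=> pp Kk; apply: positive_at_regular => /=.
by case: insubP => [K' _ _|]; [exact: pp | rewrite Kk eqxx].
Qed.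

Lemma positive_at_init :
  (k <= n)%N -> gcone_pos p -> seed_positive_at (init_seed k n R).
Proof.
by move=> kn pp [ij|a]; apply: positive_at_plucker => //; exact: card_label_set.
Qed.

End PositiveAt.

Theorem mainTheorem4 (R : realType) (k n : nat)
    (hk : (4 <= k + 2)%N) (hn : (k + 2 <= n)%N)
    (y : {fraction coord_ring R k n}) :
  cluster_variable (init_seed k n R) y ->
  forall p : gcone R k n, gcone_pos p ->
  exists2 c : R[i], takes_value y p c & 0 < c.
Proof.
move=> [S S0S [z ->]] p pp.
apply: (positive_at_mutation_equiv S0S _ (inl z)).
by apply: positive_at_init => //; apply: leq_trans hn; exact: leq_addr.
Qed.
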